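(* Let $p > 1$ be an integer. Then for $|x|<1$, $$\sin_p^{-1}x=\sum_{k=0}^\infty\left(\frac{p-1}{p}\right)^{(k)}\frac{x^{kp+1}}{k!\,(kp+1)},$$ and this is the Taylor series of $\sin_p^{-1}$ at $x=0$.
   Context: For an integer $p>1$ and $|x|<1$, $\sin_p^{-1}x = \int_0^x \frac{dt}{(1-t^p)^{\frac{p-1}{p}}}$. The notation $a^{(k)}$ denotes the rising factorial $a^{(k)} = a(a+1)(a+2)\cdots(a+k-1)$, with $a^{(0)}=1$. *)

(* Defs.v *)
From Stdlib Require Import Reals Factorial.
From Coquelicot Require Import Coquelicot.
Open Scope R_scope.

Fixpoint rising_fact (a : R) (k : nat) : R :=
  match k with
  | O => 1
  | S j => rising_fact a j * (a + INR j)
  end.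

(* On |t| < 1 the base 1 - t ^ p is positive, so Rpower is the genuine real
   power there; only the values of arcsin_p at |x| < 1 are meaningful. *)
Definition arcsin_p (p : nat) (x : R) : R :=
  RInt (fun t => 1 / Rpower (1 - t ^ p) ((INR p - 1) / INR p)) 0 x.

(* Derive_n is total, so the existence of all derivatives is required
   separately: f is n times differentiable near a, for every n.  *)
Definition is_taylor_series (f : R -> R) (a : R) (c : nat -> R) : Prop :=
  (forall n : nat, locally a (fun y => ex_derive_n f n y)) /\
  (forall n : nat, c n = Derive_n f n a / INR (fact n)).

(* Main.v *)
Require Import Defs.
From Stdlib Require Import Reals Factorial Lra Lia.
From Coquelicot Require Import Coquelicot.
Open Scope R_scope.

(** The integrand is a binomial series in [t ^ p], integrated term by term.

    Write [a = (p - 1) / p], so that [0 <= a <= 1].  The binomial coefficients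
    [b k = a^(k) / k!] lie in [[0, 1]], hence their power series [B] converges on
    [(-1, 1)]; the recurrence [(k + 1) b (k + 1) = (a + k) b k] says that
    [(1 - u) B' u = a B u], so [B u (1 - u) ^ a] has derivative zero and equals
    its value [1] at [u = 0] ([binomial_series]).  Substituting [u = t ^ p]
    writes the integrand as the power series whose coefficients are the [b k]
    placed at the multiples of [p] ([PSeries_dilate]).  Its primitive is a power
    series of radius at least [1], equal to [arcsin_p] on [(-1, 1)]
    ([arcsin_p_PSeries]).

    Both claims are read off this power series: it is infinitely differentiable
    inside its disk with derivatives at [0] given by its coefficients, and its
    only nonzero terms have index [k * p + 1], so dropping the others gives the
    stated sum ([is_series_sparse]). *)

(** * Series supported on an arithmetic progression *)

Lemma sum_n_add_zeros (u : nat -> R) (n m : nat) :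
  (forall i, (n < i <= n + m)%nat -> u i = 0) ->
  sum_n u (n + m) = sum_n u n.
Proof.
  induction m as [|m IH]; intros Hu.
  - now rewrite Nat.add_0_r.
  - rewrite Nat.add_succ_r, sum_Sn, IH.
    + rewrite (Hu (S (n + m))) by lia. apply Rplus_0_r.
    + intros i Hi. apply Hu. lia.
Qed.

(** The partial sums of the reduced series are the partial sums of [u] at the
    indices [k * p + r], hence a subsequence of a convergent sequence. *)
Lemma is_series_sparse (u : nat -> R) (p r : nat) (l : R) :
  (r < p)%nat ->
  (forall n, (forall k, n <> (k * p + r)%nat) -> u n = 0) ->
  is_series u l -> is_series (fun k => u (k * p + r)%nat) l.
Proof.
  intros Hr Hu Hl.
  assert (Hgap : forall k i, (k * p + r < i < S k * p + r)%nat -> u i = 0).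
  { intros k i Hi. apply Hu. intros j ->.
    destruct (Nat.le_gt_cases j k) as [Hj|Hj]; nia. }
  assert (Hsum : forall k,
    sum_n (fun j => u (j * p + r)%nat) k = sum_n u (k * p + r)).
  { induction k as [|k IH].
    - rewrite sum_O. simpl. destruct r as [|r']; [now rewrite sum_O|].
      rewrite sum_Sn, <- (Nat.add_0_l r'), sum_n_add_zeros, sum_O.
      + rewrite (Hu 0%nat) by lia. symmetry. apply Rplus_0_l.
      + intros i Hi. apply Hu. intros [|j]; nia.
    - rewrite sum_Sn, IH.
      replace (S k * p + r)%nat with (S ((k * p + r) + pred p)) by lia.
      rewrite sum_Sn, (sum_n_add_zeros _ (k * p + r)); [reflexivity|].
      intros i Hi. apply (Hgap k). lia. }
  unfold is_series.
  apply filterlim_ext with (fun k => sum_n u (k * p + r)).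
  { intros k. now rewrite Hsum. }
  apply (filterlim_comp _ _ _ (fun k => (k * p + r)%nat) (sum_n u) _ eventually);
    [|exact Hl].
  apply eventually_subseq. intros n. lia.
Qed.

(** * Power series with bounded coefficients *)

Lemma CV_radius_ge_1 (a : nat -> R) :
  (forall n, Rabs (a n) <= 1) -> Rbar_le 1 (CV_radius a).
Proof.
  intros Ha. apply (proj1 (CV_radius_bounded a)).
  exists 1. intros n. rewrite pow1, Rmult_1_r. apply Ha.
Qed.

Lemma Rabs_lt_CV_radius (a : nat -> R) (x : R) :
  (forall n, Rabs (a n) <= 1) -> Rabs x < 1 -> Rbar_lt (Rabs x) (CV_radius a).
Proof.
  intros Ha Hx. apply Rbar_lt_le_trans with (1 : Rbar); [exact Hx|].
  now apply CV_radius_ge_1.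
Qed.

(** Coefficients of [t |-> PSeries b (t ^ p)]. *)
Definition dilate (p : nat) (b : nat -> R) (n : nat) : R :=
  if Nat.eqb (n mod p) 0 then b (n / p)%nat else 0.

Lemma dilate_mult (p : nat) (b : nat -> R) (k : nat) :
  (0 < p)%nat -> dilate p b (k * p) = b k.
Proof.
  intros Hp. unfold dilate.
  rewrite Nat.Div0.mod_mul, Nat.div_mul by lia. reflexivity.
Qed.

Lemma dilate_zero (p : nat) (b : nat -> R) (n : nat) :
  (forall k, n <> (k * p)%nat) -> dilate p b n = 0.
Proof.
  intros Hn. unfold dilate. destruct (Nat.eqb_spec (n mod p) 0) as [H|]; auto.
  exfalso. apply (Hn (n / p)%nat).
  pose proof (Nat.div_mod_eq n p). lia.
Qed.

Lemma dilate_bounded (p : nat) (b : nat -> R) :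
  (forall n, Rabs (b n) <= 1) -> forall n, Rabs (dilate p b n) <= 1.
Proof.
  intros Hb n. unfold dilate. destruct (Nat.eqb _ _); auto.
  rewrite Rabs_R0. lra.
Qed.

Lemma PSeries_dilate (p : nat) (b : nat -> R) (t : R) :
  (0 < p)%nat -> (forall n, Rabs (b n) <= 1) -> Rabs t < 1 ->
  PSeries (dilate p b) t = PSeries b (t ^ p).
Proof.
  intros Hp Hb Ht. symmetry. apply is_series_unique.
  pose proof (PSeries_correct _ _ (CV_radius_inside _ _
    (Rabs_lt_CV_radius _ t (dilate_bounded p b Hb) Ht))) as H.
  apply is_pseries_R in H.
  apply (is_series_sparse _ p 0) in H; [|exact Hp|].
  - revert H. apply is_series_ext. intros k.
    rewrite Nat.add_0_r, dilate_mult by exact Hp.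
    now rewrite Nat.mul_comm, pow_mult.
  - intros n Hn. rewrite dilate_zero; [ring|].
    intros k. specialize (Hn k). lia.
Qed.

(** * The binomial series *)

Definition binom_coef (a : R) (k : nat) : R := rising_fact a k / INR (fact k).

Lemma binom_coef_S (a : R) (k : nat) :
  INR (S k) * binom_coef a (S k) = (a + INR k) * binom_coef a k.
Proof.
  unfold binom_coef. simpl rising_fact.
  rewrite fact_simpl, mult_INR. field.
  split; [apply INR_fact_neq_0|apply not_0_INR; lia].
Qed.

(** Passing from [k] to [k + 1] multiplies the coefficient by
    [(a + k) / (k + 1)], a number in [[0, 1]]. *)
Lemma binom_coef_bounds (a : R) (k : nat) :
  0 <= a <= 1 -> 0 <= binom_coef a k <= 1.
Proof.
  intros Ha. induction k as [|k IH].
  - unfold binom_coef. simpl. lra.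
  - pose proof (binom_coef_S a k) as H. pose proof (pos_INR k) as Hk.
    rewrite S_INR in H. split.
    + apply Rmult_le_reg_l with (INR k + 1); [lra|]. rewrite H. nra.
    + apply Rmult_le_reg_l with (INR k + 1); [lra|]. rewrite H. nra.
Qed.

Lemma binom_coef_Rabs (a : R) (k : nat) :
  0 <= a <= 1 -> Rabs (binom_coef a k) <= 1.
Proof.
  intros Ha. destruct (binom_coef_bounds a k Ha).
  rewrite Rabs_pos_eq; assumption.
Qed.

(** The recurrence [binom_coef_S], summed against [u ^ k]: multiplying the
    [k]-th coefficient by [k] is the operator [u * d/du]. *)
Lemma binomial_ode (a u : R) :
  0 <= a <= 1 -> Rabs u < 1 ->
  PSeries (PS_derive (binom_coef a)) u =
  a * PSeries (binom_coef a) u + u * PSeries (PS_derive (binom_coef a)) u.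
Proof.
  intros Ha Hu.
  assert (Hr : Rbar_lt (Rabs u) (CV_radius (binom_coef a))).
  { apply Rabs_lt_CV_radius; [|exact Hu]. intros n. now apply binom_coef_Rabs. }
  rewrite <- PSeries_incr_1, <- PSeries_scal, <- PSeries_plus.
  - apply PSeries_ext. intros n. unfold PS_derive.
    rewrite binom_coef_S. unfold PS_plus, PS_scal, PS_incr_1.
    destruct n as [|n].
    + change (INR 0) with 0.
      change ((a + 0) * binom_coef a 0 = a * binom_coef a 0 + 0). ring.
    + change ((a + INR (S n)) * binom_coef a (S n) =
        a * binom_coef a (S n) + INR (S n) * binom_coef a (S n)). ring.
  - apply ex_pseries_scal; [apply Rmult_comm|]. now apply CV_radius_inside.
  - apply CV_radius_inside. rewrite CV_radius_incr_1.
    now rewrite CV_radius_derive.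
Qed.

Lemma binomial_series (a u : R) :
  0 <= a <= 1 -> Rabs u < 1 ->
  PSeries (binom_coef a) u = 1 / Rpower (1 - u) a.
Proof.
  intros Ha Hu.
  set (h := fun v => PSeries (binom_coef a) v * Rpower (1 - v) a).
  assert (Hd : forall v, Rabs v < 1 -> is_derive h v 0).
  { intros v Hv. unfold h, Rpower.
    assert (HB : is_derive (PSeries (binom_coef a)) v
                   (PSeries (PS_derive (binom_coef a)) v)).
    { apply is_derive_PSeries, Rabs_lt_CV_radius; [|exact Hv].
      intros n. now apply binom_coef_Rabs. }
    pose proof (binomial_ode a v Ha Hv) as Hode.
    assert (Hv1 : 0 < 1 - v) by (apply Rabs_def2 in Hv; lra).
    assert (HE : is_derive (fun v => exp (a * ln (1 - v))) v
                   (- (a / (1 - v)) * exp (a * ln (1 - v)))).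
    { auto_derive; [exact Hv1|]. unfold Rdiv, Rminus. ring. }
    (* The differential equation makes the product-rule expression vanish. *)
    assert (Hz : PSeries (PS_derive (binom_coef a)) v * exp (a * ln (1 - v)) +
      PSeries (binom_coef a) v * (- (a / (1 - v)) * exp (a * ln (1 - v))) = 0).
    { replace (PSeries (PS_derive (binom_coef a)) v)
        with (a * PSeries (binom_coef a) v / (1 - v)).
      - field. lra.
      - apply Rmult_eq_reg_r with (1 - v); [|lra].
        field_simplify; [|lra]. lra. }
    rewrite <- Hz.
    apply (is_derive_mult _ _ v _ _ HB HE Rmult_comm). }
  assert (Hseg : forall v, Rmin 0 u <= v <= Rmax 0 u -> Rabs v < 1).
  { intros v. apply Rabs_def2 in Hu. unfold Rmin, Rmax.
    destruct (Rle_dec 0 u); intros Hv; apply Rabs_def1; lra. }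
  assert (Hh : h u = h 0).
  { destruct (MVT_gen h 0 u (fun _ => 0)) as [c [_ Hc]]; [| |lra].
    - intros v Hv. apply Hd, Hseg. lra.
    - intros v Hv. apply continuity_pt_filterlim, (ex_derive_continuous h).
      exists 0. now apply Hd, Hseg. }
  assert (H0 : h 0 = 1).
  { unfold h. rewrite PSeries_0, Rminus_0_r. unfold Rpower, binom_coef.
    rewrite ln_1, Rmult_0_r, exp_0. simpl. field. }
  assert (HR : Rpower (1 - u) a <> 0) by apply Rgt_not_eq, exp_pos.
  apply Rmult_eq_reg_r with (Rpower (1 - u) a); [|exact HR].
  rewrite H0 in Hh. unfold h in Hh. rewrite Hh. field. exact HR.
Qed.

(** * The power series of [arcsin_p] *)

Lemma exponent_bounds (p : nat) :
  (0 < p)%nat -> 0 <= (INR p - 1) / INR p <= 1.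
Proof.
  intros Hp. apply le_INR in Hp. simpl in Hp.
  replace ((INR p - 1) / INR p) with (1 - / INR p) by (field; lra).
  assert (0 < / INR p) by (apply Rinv_0_lt_compat; lra).
  assert (/ INR p <= / 1) by (apply Rinv_le_contravar; lra).
  rewrite Rinv_1 in *. lra.
Qed.

Definition integrand_coef (p : nat) : nat -> R :=
  dilate p (binom_coef ((INR p - 1) / INR p)).

Lemma integrand_coef_bounded (p : nat) :
  (0 < p)%nat -> forall n, Rabs (integrand_coef p n) <= 1.
Proof.
  intros Hp. apply dilate_bounded. intros k.
  now apply binom_coef_Rabs, exponent_bounds.
Qed.

Lemma pow_lt_1_Rabs (t : R) (n : nat) :
  (0 < n)%nat -> Rabs t < 1 -> Rabs (t ^ n) < 1.
Proof.
  intros Hn Ht. rewrite <- RPow_abs. apply pow_lt_1_compat; [|exact Hn].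
  split; [apply Rabs_pos|exact Ht].
Qed.

Lemma arcsin_p_PSeries (p : nat) (x : R) :
  (0 < p)%nat -> Rabs x < 1 ->
  arcsin_p p x = PSeries (PS_Int (integrand_coef p)) x.
Proof.
  intros Hp Hx. pose proof (exponent_bounds p Hp) as Ha.
  rewrite <- RInt_PSeries.
  - apply RInt_ext. intros t Ht.
    assert (Ht1 : Rabs t < 1).
    { apply Rabs_def2 in Hx. revert Ht. unfold Rmin, Rmax.
      destruct (Rle_dec 0 x); intros Ht; apply Rabs_def1; lra. }
    unfold integrand_coef. rewrite PSeries_dilate; [|exact Hp| |exact Ht1].
    + symmetry. apply binomial_series; [exact Ha|]. now apply pow_lt_1_Rabs.
    + intros n. now apply binom_coef_Rabs.
  - apply Rabs_lt_CV_radius; [|exact Hx]. now apply integrand_coef_bounded.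
Qed.

Lemma PS_Int_integrand_coef (p k : nat) :
  (0 < p)%nat ->
  PS_Int (integrand_coef p) (k * p + 1)%nat =
  rising_fact ((INR p - 1) / INR p) k / (INR (fact k) * INR (k * p + 1)).
Proof.
  intros Hp. rewrite Nat.add_1_r. simpl PS_Int. unfold integrand_coef.
  rewrite dilate_mult by exact Hp. unfold binom_coef.
  change (match (k * p)%nat with 0%nat => 1 | S _ => INR (k * p) + 1 end)
    with (INR (S (k * p))).
  field. split; [apply not_0_INR; lia|apply INR_fact_neq_0].
Qed.

Lemma PS_Int_integrand_coef_zero (p n : nat) :
  (forall k, n <> (k * p + 1)%nat) -> PS_Int (integrand_coef p) n = 0.
Proof.
  intros Hn. destruct n as [|n]; [reflexivity|].
  unfold PS_Int, integrand_coef. rewrite dilate_zero.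
  - unfold Rdiv. ring.
  - intros k. specialize (Hn k). lia.
Qed.

(** Derivatives of every order depend only on the germ of the function, so they
    are those of any power series of positive radius that agrees with it. *)
Lemma PSeries_is_taylor_series (f : R -> R) (c : nat -> R) :
  Rbar_le 1 (CV_radius c) ->
  (forall x, Rabs x < 1 -> f x = PSeries c x) ->
  is_taylor_series f 0 c.
Proof.
  intros Hc Hf.
  assert (Hloc : forall y, Rabs y < 1 -> locally y (fun t => PSeries c t = f t)).
  { intros y Hy.
    assert (Hr : 0 < 1 - Rabs y) by lra.
    exists (mkposreal _ Hr). intros t Ht. symmetry. apply Hf.
    assert (Ht' : Rabs (t - y) < 1 - Rabs y) by exact Ht.
    replace t with ((t - y) + y) by ring.
    pose proof (Rabs_triang (t - y) y). lra. }
  split; intros n.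
  - exists (mkposreal 1 Rlt_0_1). intros y Hy.
    assert (Hy' : Rabs y < 1).
    { rewrite <- (Rminus_0_r y). exact Hy. }
    apply (ex_derive_n_ext_loc (PSeries c)); [now apply Hloc|].
    apply ex_derive_n_PSeries.
    now apply Rbar_lt_le_trans with (1 : Rbar).
  - rewrite <- (Derive_n_ext_loc (PSeries c)).
    + rewrite Derive_n_coef.
      * field. apply INR_fact_neq_0.
      * apply Rbar_lt_le_trans with (1 : Rbar); [exact Rlt_0_1|exact Hc].
    + apply Hloc. rewrite Rabs_R0. lra.
Qed.

Theorem proposition3p4 (p : nat) (hp : (1 < p)%nat) :
  (forall x : R, Rabs x < 1 ->
     is_series
       (fun k : nat =>
          rising_fact ((INR p - 1) / INR p) k *
          (x ^ (k * p + 1) / (INR (fact k) * INR (k * p + 1))))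
       (arcsin_p p x)) /\
  (exists c : nat -> R,
     (forall k : nat,
        c (k * p + 1)%nat =
        rising_fact ((INR p - 1) / INR p) k /
        (INR (fact k) * INR (k * p + 1))) /\
     (forall n : nat, (forall k : nat, n <> (k * p + 1)%nat) -> c n = 0) /\
     is_taylor_series (arcsin_p p) 0 c).
Proof.
  assert (Hp : (0 < p)%nat) by lia.
  pose proof (integrand_coef_bounded p Hp) as Hbound.
  split.
  - intros x Hx. rewrite arcsin_p_PSeries by assumption.
    assert (H : is_pseries (PS_Int (integrand_coef p)) x
                  (PSeries (PS_Int (integrand_coef p)) x)).
    { apply PSeries_correct, CV_radius_inside. rewrite CV_radius_Int.
      now apply Rabs_lt_CV_radius. }
    apply is_pseries_R in H.
    apply (is_series_sparse _ p 1) in H; [|exact hp|].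
    + revert H. apply is_series_ext. intros k.
      rewrite PS_Int_integrand_coef by exact Hp. unfold Rdiv.
      rewrite Rmult_assoc. f_equal. apply Rmult_comm.
    + intros n Hn. rewrite PS_Int_integrand_coef_zero by exact Hn. ring.
  - exists (PS_Int (integrand_coef p)). split; [|split].
    + intros k. now apply PS_Int_integrand_coef.
    + intros n. apply PS_Int_integrand_coef_zero.
    + apply PSeries_is_taylor_series.
      * rewrite CV_radius_Int. now apply CV_radius_ge_1.
      * intros x Hx. now apply arcsin_p_PSeries.
Qed.
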